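(* For $k\ge 1$, let $\mathfrak{g}_k=\mathfrak{p}^A\frac{k+1|k}{2k+1}$ (a Frobenius type-A seaweed). The spectrum of $\mathfrak{g}_k$ is $\{-1,0^2,1^2,2\}$ if $k=1$, and is $$\{-k,0^{3k-1},1^{3k-1},k+1\}\cup\bigcup_{i=1}^{k-1}\{(-k+i)^{3i},(k-i+1)^{3i}\}$$ for $k>1$.
   Context: Type-A seaweeds: for compositions $\underline a=(a_1,\dots,a_m)$ and $\underline b=(b_1,\dots,b_t)$ of $n$, let $e_1,\dots,e_n$ be a basis of $V=\mathbb{C}^n$, $V_i=\mathrm{span}\{e_1,\dots,e_{a_1+\dots+a_i}\}$ and $W_j=\mathrm{span}\{e_{b_1+\dots+b_j+1},\dots,e_n\}$. The type-A seaweed $\mathfrak{p}^A\frac{a_1|\cdots|a_m}{b_1|\cdots|b_t}$ is the subalgebra of $\mathfrak{sl}(n)$ of matrices preserving both flags $0\subset V_1\subset\dots\subset V_m=V$ and $V=W_0\supset W_1\supset\dots\supset W_t=0$. A Lie algebra $\mathfrak{g}$ is Frobenius if there is $F\in\mathfrak{g}^*$ with $(x,y)\mapsto F([x,y])$ nondegenerate; then there is a unique $\widehat F\in\mathfrak{g}$ with $F([\widehat F,x])=F(x)$ for all $x$, and the spectrum of $\mathfrak{g}$ is the multiset of eigenvalues of $\mathrm{ad}\,\widehat F$ on $\mathfrak{g}$ (independent of the choice of Frobenius $F$). Notation: $\{x^k\}$ denotes $x$ with multiplicity $k$, and $\cup$ denotes multiset union (multiplicities add). *)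

(* Defs.v *)
From HB Require Import structures.
From mathcomp Require Import all_boot all_order all_algebra.
From mathcomp Require Import finmap multiset.
From mathcomp Require Import reals complex ring.
Set Implicit Arguments.
Unset Strict Implicit.
Unset Printing Implicit Defensive.
Import GRing.Theory passmx.
Local Open Scope ring_scope.

HB.mixin Record Vector_isLieAlgebra (K : fieldType) L of Vector K L := {
  lie : L -> L -> L;
  lie_linearl : forall y, linear (lie^~ y);
  lie_linearr : forall x, linear (lie x);
  lie_xx : forall x, lie x x = 0;
  lie_jacobi : forall x y z,
    lie x (lie y z) + lie y (lie z x) + lie z (lie x y) = 0
}.

#[short(type="lieAlgType")]
HB.structure Definition LieAlgebra (K : fieldType) :=
  {L of Vector_isLieAlgebra K L & Vector K L}.

HB.instance Definition _ (K : fieldType) (L : lieAlgType K) (x : L) :=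
  GRing.isSemilinear.Build K L L _ (lie x)
    (GRing.semilinear_linear (lie_linearr x)).

Definition ad (K : fieldType) (L : lieAlgType K) (x : L) : 'End(L) :=
  linfun (lie x).

(* The form (x, y) |-> F [x, y] is alternating, so its left kernel is also its
   right kernel. *)
Definition frobenius_functional (K : fieldType) (L : lieAlgType K)
    (F : 'Hom(L, K^o)) : Prop :=
  forall x : L, (forall y : L, F (lie x y) = 0) -> x = 0.

Definition principal_element (K : fieldType) (L : lieAlgType K)
    (F : 'Hom(L, K^o)) (w : L) : Prop :=
  forall x : L, F (lie w x) = F x.

Lemma principal_element_exists_unique (K : fieldType) (L : lieAlgType K)
    (F : 'Hom(L, K^o)) :
  frobenius_functional F -> exists! w : L, principal_element F w.
Proof.
move=> frobF.
pose phi (w : L) : 'Hom(L, K^o) := (F \o ad w)%VF.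
have phiE w x : phi w x = F (lie w x) by rewrite comp_lfunE lfunE.
have lin_phi : linear phi.
  move=> c u v; apply/lfunP => x; rewrite add_lfunE scale_lfunE !phiE.
  by rewrite (lie_linearl x) linearP.
pose philin : {linear L -> 'Hom(L, K^o)} :=
  HB.pack phi (GRing.isSemilinear.Build K L _ _ phi
                 (GRing.semilinear_linear lin_phi)).
have ker0 : lker (linfun philin) == 0%VS.
  apply/eqP/vspaceP => x; rewrite memv_ker memv0 lfunE.
  apply/idP/idP => [/eqP phi0|/eqP ->]; last by rewrite linear0.
  apply/eqP.
  by apply: frobF => y; rewrite -phiE -[phi x]/(philin x) phi0 lfunE.
have full : limg (linfun philin) = fullv.
  apply/eqP; rewrite eqEdim subvf /= limg_dim_eq; last by rewrite (eqP ker0) capv0.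
  rewrite !dimvf; suff: (dim L * 1 <= dim L)%N by [].
  by rewrite muln1.
have /memv_imgP[w _ FE] : F \in limg (linfun philin) by rewrite full memvf.
rewrite lfunE /= in FE; exists w; split=> [x|v Fv]; first by rewrite -phiE -FE.
move/lker0P: ker0; apply; rewrite !lfunE /= -FE.
by apply/lfunP => x; rewrite phiE Fv.
Qed.

(* Eigenvalues with algebraic multiplicities: the multiset of roots of the
   characteristic polynomial. *)
Definition eigenvalue_mset (K : closedFieldType) (V : vectType K)
    (h : 'End(V)) : {mset K}%mset :=
  let e := vbasis {:V} in
  seq_mset (sval (closed_field_poly_normal (char_poly (mxof e e h)))).

(* L is Frobenius and its spectrum is S.  All Frobenius functionals are
   quantified over, as the spectrum does not depend on the chosen one; their
   principal elements exist by principal_element_exists_unique. *)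
Definition frobenius_with_spectrum (K : closedFieldType) (L : lieAlgType K)
    (S : {mset K}%mset) : Prop :=
  (exists F : 'Hom(L, K^o), frobenius_functional F) /\
  (forall (F : 'Hom(L, K^o)) (w : L),
     frobenius_functional F -> principal_element F w ->
     eigenvalue_mset (ad w) = S).

Definition stabilizer (K : fieldType) (n : nat) (U : {vspace 'cV[K]_n}) :
    {vspace 'M[K]_n} :=
  (\bigcap_(v <- vbasis U) (linfun (mulmxr v) @^-1: U))%VS.

Lemma stabilizerP (K : fieldType) (n : nat) (U : {vspace 'cV[K]_n})
    (x : 'M[K]_n) :
  reflect (forall v, v \in U -> x *m v \in U) (x \in stabilizer U).
Proof.
have capP (s : seq 'cV[K]_n) :
    (x \in (\bigcap_(v <- s) (linfun (mulmxr v) @^-1: U))%VS)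
    = all (fun v => x *m v \in U) s.
  elim: s => [|v s IHs]; first by rewrite big_nil memvf.
  by rewrite big_cons memv_cap IHs -memv_preim lfunE.
rewrite capP; apply: (iffP allP) => [stx v Uv|stx v /vbasis_mem]; last exact: stx.
rewrite (coord_vbasis Uv) mulmx_sumr memv_suml// => i _.
by rewrite -scalemxAr memvZ// stx// mem_nth ?size_tuple.
Qed.

(* The standard basis is indexed from 0, so that e_(p+1) is delta_mx p 0. *)
Definition head_space (K : fieldType) (n : nat) (a : seq nat) (i : nat) :
    {vspace 'cV[K]_n} :=
  <<[seq delta_mx p 0%R | p : 'I_n <- enum 'I_n & (p < sumn (take i a))%N]>>%VS.

Definition tail_space (K : fieldType) (n : nat) (b : seq nat) (j : nat) :
    {vspace 'cV[K]_n} :=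
  <<[seq delta_mx p 0%R | p : 'I_n <- enum 'I_n & (sumn (take j b) <= p)%N]>>%VS.

(* The type-A seaweed of sl(n) with top row a and bottom row b, which are
   meant to be compositions of n. *)
Definition seaweed_space (K : fieldType) (n : nat) (a b : seq nat) :
    {vspace 'M[K]_n} :=
  (lker (linfun (mxtrace : 'M[K]_n -> K^o))
   :&: (\bigcap_(i < (size a).+1) stabilizer (head_space K n a i))
   :&: (\bigcap_(j < (size b).+1) stabilizer (tail_space K n b j)))%VS.

Lemma seaweed_spaceP (K : fieldType) (n : nat) (a b : seq nat) (x : 'M[K]_n) :
  reflect
    [/\ \tr x = 0,
        (forall i, (i <= size a)%N -> forall v,
           v \in head_space K n a i -> x *m v \in head_space K n a i)
      & (forall j, (j <= size b)%N -> forall v,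
           v \in tail_space K n b j -> x *m v \in tail_space K n b j)]
    (x \in seaweed_space K n a b).
Proof.
have capP m (U : nat -> {vspace 'M[K]_n}) :
    reflect (forall i, (i < m)%N -> x \in U i) (x \in (\bigcap_(i < m) U i)%VS).
  apply: (iffP idP) => [xU i lt_im|xU].
    by move: xU; rewrite memvE => /subv_bigcapP/(_ (Ordinal lt_im) isT).
  by rewrite memvE; apply/subv_bigcapP => i _; exact: xU.
have stabP m (U : nat -> {vspace 'cV[K]_n}) :
    reflect (forall i, (i < m)%N -> forall v, v \in U i -> x *m v \in U i)
            (x \in (\bigcap_(i < m) stabilizer (U i))%VS).
  apply: (iffP (capP m (fun i => stabilizer (U i)))) => xU i lt_im.
    by apply/stabilizerP; exact: xU.
  by apply/stabilizerP; exact: xU.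
rewrite /seaweed_space !memv_cap memv_ker lfunE /=.
apply: (iffP andP) => [[/andP[/eqP tr0]]|[tr0 xa xb]].
  by move=> /(stabP _ (head_space K n a)) xa /(stabP _ (tail_space K n b)) xb.
split; last exact/(stabP _ (tail_space K n b)).
by rewrite tr0 eqxx; exact/(stabP _ (head_space K n a)).
Qed.

Lemma seaweed_space_lie (K : fieldType) (n : nat) (a b : seq nat)
    (x y : 'M[K]_n) :
  x \in seaweed_space K n a b -> y \in seaweed_space K n a b ->
  x *m y - y *m x \in seaweed_space K n a b.
Proof.
move=> /seaweed_spaceP[_ xa xb] /seaweed_spaceP[_ ya yb].
apply/seaweed_spaceP; split=> [|i le_i v vU|j le_j v vU].
- by rewrite linearB /= mxtrace_mulC subrr.
- by rewrite mulmxBl -!mulmxA memvB// (xa, ya)// (xa, ya).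
- by rewrite mulmxBl -!mulmxA memvB// (xb, yb)// (xb, yb).
Qed.

Definition seaweed (K : fieldType) (n : nat) (a b : seq nat) : predArgType :=
  subvs_of (seaweed_space K n a b).

HB.instance Definition _ (K : fieldType) (n : nat) (a b : seq nat) :=
  Vector.on (seaweed K n a b).

Definition seaweed_lie (K : fieldType) (n : nat) (a b : seq nat)
    (x y : seaweed K n a b) : seaweed K n a b :=
  Subvs (seaweed_space_lie (subvsP x) (subvsP y)).

Lemma seaweed_lie_linearl (K : fieldType) (n : nat) (a b : seq nat)
    (y : seaweed K n a b) : linear ((@seaweed_lie K n a b)^~ y).
Proof.
move=> c u v; apply/val_inj; rewrite [RHS]linearP /= linearP /= mulmxDl.
by rewrite -scalemxAl scalerBr opprD addrACA.
Qed.

Lemma seaweed_lie_linearr (K : fieldType) (n : nat) (a b : seq nat)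
    (x : seaweed K n a b) : linear (seaweed_lie x).
Proof.
move=> c u v; apply/val_inj; rewrite [RHS]linearP /= linearP /= mulmxDl.
by rewrite -scalemxAl scalerBr opprD addrACA.
Qed.

Lemma seaweed_lie_xx (K : fieldType) (n : nat) (a b : seq nat)
    (x : seaweed K n a b) : seaweed_lie x x = 0.
Proof. by apply/val_inj; rewrite /= subrr. Qed.

Lemma seaweed_lie_jacobi (K : fieldType) (n : nat) (a b : seq nat)
    (x y z : seaweed K n a b) :
  seaweed_lie x (seaweed_lie y z) + seaweed_lie y (seaweed_lie z x)
  + seaweed_lie z (seaweed_lie x y) = 0.
Proof.
apply/val_inj; rewrite /= !mulmxBl !mulmxBr !mulmxA !opprB.
move: (_ *m vsval y *m vsval z) (_ *m vsval z *m vsval y)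
  (_ *m vsval z *m vsval x) (_ *m vsval y *m vsval x)
  (_ *m vsval x *m vsval z) (_ *m vsval x *m vsval y) => A B C D E G.
by apply/matrixP => i j; rewrite !mxE; ring.
Qed.

HB.instance Definition _ (K : fieldType) (n : nat) (a b : seq nat) :=
  Vector_isLieAlgebra.Build K (seaweed K n a b)
    (@seaweed_lie_linearl K n a b) (@seaweed_lie_linearr K n a b)
    (@seaweed_lie_xx K n a b) (@seaweed_lie_jacobi K n a b).

(* Main.v *)
Require Import Defs.
From HB Require Import structures.
From mathcomp Require Import all_boot all_order all_algebra.
From mathcomp Require Import finmap multiset.
From mathcomp Require Import reals complex.
From mathcomp Require Import zify ring.
Import GRing.Theory Num.Theory passmx.
Set Implicit Arguments.
Unset Strict Implicit.
Unset Printing Implicit Defensive.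
Local Open Scope ring_scope.

(* Write a functional on the maximal parabolic as x |-> tr(Mx), M having blocks
   P, C, S (upper left, lower left, lower right), and its principal element as w
   with diagonal blocks A, D and upper right block B.  After conjugation by a
   unipotent, S = 0, and the pair C, Q = CP of linear maps K^(k+1) -> K^k
   satisfies CA = (D+1)C and QA = (D+2)Q.  Nondegeneracy of the form forces
   the pencil (C, Q) to be the indecomposable Kronecker block; the vectors
   obtained from ker C by iterating Q and C^(-1) then triangularize A and D, whose
   eigenvalues are a, a-1, ..., a-k and a-2, ..., a-1-k for some a.  The spectrum is
   the multiset of differences on the three blocks of the parabolic, with one 0
   removed for the scalar matrices; this holds for every Frobenius functional,
   so the independence of the choice needs no separate argument. *)

(** * Krylov matrices *)

Lemma char_poly_conj (K : fieldType) (n : nat) (A B G : 'M[K]_n) :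
  G \in unitmx -> G *m A = B *m G -> char_poly A = char_poly B.
Proof.
move=> uG GA; pose G' := map_mx (@polyC K) G.
have detG' : \det G' != 0 by rewrite det_map_mx polyC_eq0 -unitfE.
apply: (mulfI detG'); rewrite /char_poly -det_mulmx [RHS]mulrC -det_mulmx.
congr (\det _); rewrite /char_poly_mx mulmxBr mulmxBl scalar_mxC.
by rewrite -!map_mxM GA.
Qed.

Lemma char_poly_tr (K : comNzRingType) (n : nat) (A : 'M[K]_n) :
  char_poly A^T = char_poly A.
Proof.
rewrite /char_poly -[RHS]det_tr; congr (\det _).
by apply/matrixP => i j; rewrite !mxE eq_sym.
Qed.

Lemma char_poly_lblock (K : comNzRingType) (m n : nat) (A : 'M[K]_m)
    (B : 'M[K]_(n, m)) (D : 'M[K]_n) :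
  char_poly (block_mx A 0 B D) = char_poly A * char_poly D.
Proof.
rewrite /char_poly /char_poly_mx map_block_mx (scalar_mx_block m n 'X).
by rewrite opp_block_mx add_block_mx map_mx0 subr0 det_lblock.
Qed.

Definition krylov_mx (K : fieldType) (n : nat) (X : 'M[K]_n) (y : 'cV[K]_n) :
    'M[K]_n :=
  \matrix_(i, j) (iter j (mulmx X) y) i 0.

Lemma mulmx_krylov (K : fieldType) (n m : nat) (X : 'M[K]_n) (y : 'cV[K]_n)
    (B : 'M[K]_(m, n)) i j :
  (B *m krylov_mx X y) i j = (B *m iter j (mulmx X) y) i 0.
Proof. by rewrite !mxE; apply: eq_bigr => l _; rewrite mxE. Qed.

(** This is Cayley-Hamilton: the monic characteristic polynomial is solved for its leading power and
    applied to [y]. *)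
Lemma krylov_expansion (K : fieldType) (n : nat) (X : 'M[K]_n) (y : 'cV[K]_n) :
  exists c : 'I_n -> K,
    iter n (mulmx X) y = \sum_(i < n) c i *: iter i (mulmx X) y.
Proof.
case: n X y => [|n] X y; first by exists (fun=> 0); rewrite flatmx0 [RHS]flatmx0.
have iterE i : iter i (mulmx X) y = X ^+ i *m y.
  by elim: i => [|i IH]; rewrite ?mul1mx//= IH exprS mulmxA.
exists (fun i => - (char_poly X)`_i).
have := Cayley_Hamilton X; rewrite -{1}[char_poly X]coefK poly_def rmorph_sum /=.
rewrite size_char_poly big_ord_recr /=.
have -> : (char_poly X)`_n.+1 = 1.
  by have /monicP := char_poly_monic X; rewrite /lead_coef size_char_poly.
rewrite scale1r rmorphXn /= horner_mx_X => /(canRL (addKr _)).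
rewrite addr0 -[X in _ -> X = _]/(iter n.+1 (mulmx _) y) iterE => ->.
rewrite mulNmx mulmx_suml -sumrN.
apply: eq_bigr => i _.
by rewrite iterE linearZ /= rmorphXn /= horner_mx_X -scalemxAl scaleNr.
Qed.

(** Hautus' controllability test. The left kernel of the Krylov matrix is stable under [X], so over
    an algebraically closed field a nonzero kernel contains a left eigenvector of [X]. It kills [y],
    the first Krylov column, contrary to [noeig]. *)
Lemma krylov_unitmx (K : numClosedFieldType) (n : nat) (X : 'M[K]_n)
    (y : 'cV[K]_n) :
  (forall (c : K) (v : 'rV[K]_n), v *m X = c *: v -> v *m y = 0 -> v = 0) ->
  krylov_mx X y \in unitmx.
Proof.
move=> noeig; set Y := krylov_mx X y; rewrite -row_free_unit -kermx_eq0.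
apply/negPn/negP => kerN0.
have kerX : stablemx (kermx Y) X.
  apply/sub_kermxP/matrixP => i j; rewrite -mulmxA [in LHS]mxE.
  transitivity ((row i (kermx Y) *m (X *m Y)) 0 j).
    by rewrite mxE; apply: eq_bigr => l _; rewrite [row _ _ _ _]mxE.
  set v := row i (kermx Y); rewrite mulmxA mulmx_krylov -mulmxA -iterS [RHS]mxE.
  have vY l : (l < n)%N -> v *m iter l (mulmx X) y = 0.
    move=> lt_ln; apply/matrixP => i' j'; rewrite !ord1.
    rewrite -(mulmx_krylov _ _ _ 0 (Ordinal lt_ln)) -/Y /v -row_mul mulmx_ker.
    by rewrite !mxE.
  suff -> : v *m iter j.+1 (mulmx X) y = 0 by rewrite mxE.
  (* For the last column, [X^n y] is no longer a Krylov column and has to be expanded in the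
     previous ones. *)
  have [|le_nj] := ltnP j.+1 n; first exact: vY.
  have -> : j.+1 = n by apply/eqP; rewrite eqn_leq le_nj ltn_ord.
  have [c ->] := krylov_expansion X y; rewrite mulmx_sumr big1// => l _.
  by rewrite -scalemxAr vY ?scaler0.
have rk_gt0 : (0 < \rank (kermx Y))%N by rewrite lt0n mxrank_eq0.
have [c /eigenvalueP[v vP v0]] := eigenvalue_closed (restrictmx (kermx Y) X) rk_gt0.
pose W := row_base (kermx Y).
have vW : v *m W *m X = c *: (v *m W).
  have WX : (W *m X <= W)%MS by rewrite stablemx_row_base.
  by rewrite -mulmxA -(mulmxKpV WX) mulmxA vP -scalemxAl.
have vWy : v *m W *m y = 0.
  have WY : W *m Y = 0.
    by apply/sub_kermxP; rewrite eq_row_base.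
  have n_gt0 : (0 < n)%N := leq_trans rk_gt0 (rank_leq_row _).
  apply/matrixP => i j; rewrite !ord1.
  rewrite -[y]/(iter (Ordinal n_gt0) (mulmx X) y) -mulmx_krylov -/Y.
  by rewrite -mulmxA WY mulmx0 !mxE.
have := noeig c _ vW vWy.
by move/eqP; rewrite mulmx_free_eq0 ?row_base_free// (negbTE v0).
Qed.

(** Moving [D] past one factor [X] lowers the eigenvalue by 1, and the rank-one term [y *m r] only
    adds earlier Krylov vectors. Hence [D] is upper triangular in the Krylov basis. *)
Lemma char_poly_krylov (K : fieldType) (n : nat) (X D : 'M[K]_n)
    (y : 'cV[K]_n) (r : 'rV[K]_n) (b : K) :
  krylov_mx X y \in unitmx -> D *m y = b *: y ->
  D *m X = X *m D - X + y *m r ->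
  char_poly D = \prod_(i < n) ('X - (b - i%:R)%:P).
Proof.
move=> uY Dy DX; pose z i := iter i (mulmx X) y.
have Dz j : D *m z j = (b - j%:R) *: z j
    + \sum_(i < j) (r *m z (j.-1 - i)%N) 0 0 *: z i.
  elim: j => [|j IH]; first by rewrite big_ord0 addr0 subr0.
  rewrite {1}/z iterS -/(z j) mulmxA DX mulmxDl mulmxBl -[X *m D *m _]mulmxA IH.
  have -> : y *m r *m z j = (r *m z j) 0 0 *: y.
    by rewrite -mulmxA {1}[r *m z j]mx11_scalar mul_mx_scalar.
  rewrite mulmxDr -scalemxAr mulmx_sumr big_ord_recl /= subn0.
  have -> : b - j.+1%:R = b - j%:R - 1 by rewrite -natr1 opprD addrA.
  rewrite (scalerBl (b - j%:R) 1) scale1r.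
  rewrite -!addrA; congr (_ + _).
  rewrite addrCA; congr (_ + _); rewrite addrC; congr (_ + _).
  apply: eq_bigr => i _; rewrite -scalemxAr; congr ((r *m z _) 0 0 *: _).
  by rewrite /bump leq0n add1n subnS predn_sub.
pose T : 'M[K]_n := \matrix_(i, j)
  if i == j then b - j%:R else
  if (i < j)%N then (r *m z (j.-1 - i)%N) 0 0 else 0.
have DY : D *m krylov_mx X y = krylov_mx X y *m T.
  apply/matrixP => i j; rewrite mulmx_krylov Dz [in LHS]mxE summxE [RHS]mxE.
  rewrite addrC [RHS](bigID (fun l : 'I_n => (l < j)%N)) /=.
  rewrite (big_ord_widen n (fun l => ((r *m z (j.-1 - l)%N) 0 0 *: z l) i 0)).
    congr (_ + _).
      apply: eq_bigr => l lt_lj; rewrite !mxE -val_eqE ltn_eqF// lt_lj.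
      exact: mulrC.
    rewrite (bigD1 j) ?ltnn//= big1 ?addr0.
      by rewrite !mxE eqxx mulrC.
    by move=> l /andP[/negbTE nlt /negbTE nej]; rewrite !mxE nej nlt mulr0.
  exact: ltnW.
(* The transpose is taken because [char_poly_trig] is about lower triangular matrices. *)
rewrite -char_poly_tr (@char_poly_conj _ _ _ T^T (krylov_mx X y)^T).
- rewrite char_poly_trig.
    by apply: eq_bigr => i _; rewrite !mxE eqxx.
  apply/is_trig_mxP => i j lt_ij; rewrite !mxE -val_eqE gtn_eqF//.
  by rewrite ltnNge ltnW.
- by rewrite unitmx_tr.
- by rewrite -!trmx_mul DY.
Qed.

(** * Pencils *)

Lemma wide_mx_kernel (K : fieldType) (k : nat) (T : 'M[K]_(k, k + 1)) :
  exists2 u : 'cV[K]_(k + 1), u != 0 & T *m u = 0.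
Proof.
exists (nz_row (kermx T^T))^T.
  rewrite trmx_eq0 nz_row_eq0 -mxrank_eq0 mxrank_ker mxrank_tr subn_eq0 -ltnNge.
  by rewrite [X in (_ < X)%N]addn1 ltnS rank_leq_row.
by apply: trmx_inj; rewrite trmx_mul trmxK trmx0; apply/sub_kermxP/nz_row_sub.
Qed.

(** A right inverse [E] of [C] and a kernel vector [e] form an invertible matrix [[E e]]. Taking
    [rho] as the last row of its inverse makes [[C; rho]] that inverse. *)
Lemma pencil_adapted_basis (K : fieldType) (k : nat) (C : 'M[K]_(k, k + 1)) :
  row_free C ->
  exists (E : 'M[K]_(k + 1, k)) (e : 'cV[K]_(k + 1)) (rho : 'rV[K]_(k + 1)),
    [/\ col_mx C rho \in unitmx, C *m E = 1%:M, C *m e = 0, rho *m e = 1%:M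
      & E *m C + e *m rho = 1%:M].
Proof.
move=> freeC; have [E CE] : exists E, C *m E = 1%:M.
  by exists (pinvmx C); rewrite -{1}[C]mul1mx mulmxKp.
have [e e0 Ce] := wide_mx_kernel C.
pose H := row_mx E e.
have CH : C *m H = row_mx 1%:M 0 by rewrite mul_mx_row CE Ce.
have uH : H \in unitmx.
  rewrite -unitmx_tr -row_free_unit -kermx_eq0; apply/rowV0P => v /sub_kermxP.
  move=> /(congr1 trmx); rewrite trmx_mul trmxK trmx0 -[v^T]vsubmxK mul_row_col.
  set u := usubmx _; set s := dsubmx _ => Es.
  have u0 : u = 0.
    have := congr1 (mulmx C) Es.
    by rewrite mulmxDr !mulmxA CE Ce mul0mx addr0 mul1mx mulmx0.
  move: Es; rewrite u0 mulmx0 add0r [s]mx11_scalar mul_mx_scalar => /eqP.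
  rewrite scaler_eq0 (negbTE e0) orbF => /eqP s0.
  apply: trmx_inj; rewrite trmx0 -[v^T]vsubmxK -/u -/s u0 [s]mx11_scalar s0.
  by rewrite raddf0 col_mx0.
pose rho := row_mx 0 1%:M *m invmx H.
have CrH : col_mx C rho *m H = 1%:M.
  by rewrite mul_col_mx CH mulmxKV// -block_mxEv -scalar_mx_block.
exists E, e, rho; split=> //.
- by case/mulmx1_unit: CrH.
- have := congr1 (mulmxr (col_mx 0 1%:M)) (mulmxKV uH (row_mx 0 (1%:M : 'M_1))).
  by rewrite /= -/rho -mulmxA !mul_row_col !mulmx0 !add0r !mulmx1.
- by rewrite -mul_row_col; apply: mulmx1C.
Qed.

(* With [X = Q E] and [y = Q e] in the basis of [pencil_adapted_basis], [D] sends
   [X^i y] to [(a - 2 - i) X^i y] plus a combination of the previous vectors. *)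
Lemma pencil_char_poly (K : numClosedFieldType) (k : nat)
    (C Q : 'M[K]_(k, k + 1)) (A : 'M[K]_(k + 1)) (D : 'M[K]_k) :
  row_free C ->
  (forall (c : K) (v : 'rV[K]_k), v *m Q = c *: (v *m C) -> v = 0) ->
  C *m A = D *m C + C -> Q *m A = D *m Q + Q *+ 2 ->
  exists a : K,
    char_poly A = \prod_(i < k.+1) ('X - (a - i%:R)%:P) /\
    char_poly D = \prod_(i < k) ('X - (a - 2%:R - i%:R)%:P).
Proof.
move=> /pencil_adapted_basis[E [e [rho [uG CE Ce re Ee]]]] noeig CA QA.
have [a aE] : exists a, rho *m A *m e = a%:M.
  by exists ((rho *m A *m e) 0 0); exact: mx11_scalar.
have [r rE] : exists r, rho *m A *m E = r by exists (rho *m A *m E).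
have [X XE] : exists X, Q *m E = X by exists (Q *m E).
have [y yE] : exists y, Q *m e = y by exists (Q *m e).
have QE : Q = X *m C + y *m rho by rewrite -XE -yE -!mulmxA -mulmxDr Ee mulmx1.
have rhoA : rho *m A = r *m C + a *: rho.
  by rewrite -mul_scalar_mx -aE -rE -!mulmxA -!mulmxDr Ee mulmx1.
have Ae : A *m e = a *: e.
  rewrite -[LHS]mul1mx -Ee mulmxDl -mulmxA [C *m _]mulmxA CA mulmxDl -mulmxA.
  by rewrite Ce mulmx0 addr0 mulmx0 add0r -mulmxA [rho *m _]mulmxA aE mul_mx_scalar.
have DQ : D *m Q = Q *m A - Q *+ 2 by rewrite QA addrK.
have Dy : D *m y = (a - 2%:R) *: y.
  rewrite -yE mulmxA DQ mulmxBl -mulmxA Ae -scalemxAr.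
  by rewrite -scaler_nat -scalemxAl -scalerBl.
have QAE : Q *m A *m E = X *m D + X + y *m r.
  rewrite {1}QE !mulmxDl -!(mulmxA _ _ A) CA -(mulmxA X) -(mulmxA y) rE mulmxDl.
  by rewrite -mulmxA CE mulmx1 mulmxDr mulmx1.
have DX : D *m X = X *m D - X + y *m r.
  rewrite -{1}XE mulmxA DQ mulmxBl QAE mulr2n mulmxDl XE.
  by apply/matrixP => i j; rewrite !mxE; ring.
have uY : krylov_mx X y \in unitmx.
  apply: krylov_unitmx => c v vX vy; apply: (noeig c).
  by rewrite QE mulmxDr !mulmxA vX vy mul0mx addr0 scalemxAl.
exists a; split; last exact: char_poly_krylov uY Dy DX.
(* In the coordinates [[C; rho]], [A] is block triangular with diagonal blocks [D + 1] and [a]. The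
   block [D + 1] satisfies the same commutation relation with [X] as [D], starting from [a - 1], so
   the eigenvalue [a] continues its string. *)
rewrite (@char_poly_conj _ _ _ (block_mx (D + 1%:M) 0 r a%:M) (col_mx C rho))//.
  rewrite char_poly_lblock (@char_poly_krylov _ _ X (D + 1%:M) y r (a - 1))//.
  - rewrite char_poly_trig; last by apply/is_trig_mxP => -[[|?] ?] [[|?] ?].
    rewrite big_ord1 mxE eqxx mulr1n big_ord_recl subr0 mulrC.
    congr (_ * _); apply: eq_bigr => i _.
    by rewrite lift0 -nat1r opprD addrA.
  - rewrite mulmxDl Dy mul1mx -{2}[y]scale1r -scalerDl; congr (_ *: _).
    by ring.
  - rewrite mulmxDl DX mul1mx mulmxDr mulmx1.
    by apply/matrixP => i j; rewrite !mxE; ring.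
rewrite mul_col_mx CA rhoA block_mxEv mul_col_mx !mul_row_col mul0mx addr0.
by rewrite mulmxDl mul1mx mul_scalar_mx.
Qed.

(** * Frobenius forms on a maximal parabolic *)

Lemma mulmx_cV_rV_eq0 (K : fieldType) (m n : nat) (u : 'cV[K]_m) (v : 'rV[K]_n) :
  u *m v = 0 -> u != 0 -> v = 0.
Proof.
move=> uv0 u0; apply/eqP/negPn/negP => v0.
have vfree : row_free v by rewrite /row_free rank_rV v0.
by move/eqP: uv0; rewrite mulmx_free_eq0// (negbTE u0).
Qed.

(** Each degeneracy of [C] or of the pencil yields a rank-one construction in the radical of the
    form, which [nondeg] confines to the scalars. The weight 2 of [Q = C P'] is the sum of the
    weight 1 of [C] and the weight 1 of [P']. *)
Lemma pencil_of_form (K : numClosedFieldType) (k : nat)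
    (P : 'M[K]_(k + 1)) (C : 'M[K]_(k, k + 1)) (S : 'M[K]_k)
    (A : 'M[K]_(k + 1)) (B : 'M[K]_(k + 1, k)) (D : 'M[K]_k) :
  (forall (A0 : 'M[K]_(k + 1)) (B0 : 'M[K]_(k + 1, k)) (D0 : 'M[K]_k),
     C *m A0 = D0 *m C -> P *m A0 - A0 *m P = B0 *m C ->
     C *m B0 = D0 *m S - S *m D0 ->
     exists t : K, block_mx A0 B0 0 D0 = t%:M) ->
  C *m A = D *m C + C -> P *m A - A *m P = B *m C + P ->
  C *m B = D *m S - S *m D + S ->
  exists Q : 'M[K]_(k, k + 1),
    [/\ row_free C,
      forall (c : K) (v : 'rV[K]_k), v *m Q = c *: (v *m C) -> v = 0
      & Q *m A = D *m Q + Q *+ 2].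
Proof.
move=> nondeg CA PA CB.
have freeC : row_free C.
  rewrite -kermx_eq0; apply/rowV0P => v /sub_kermxP vC.
  have [u u0 Cu] := wide_mx_kernel C.
  (* Since [C u = 0] and [v C = 0], the upper right block [u v] alone lies in the radical. *)
  have [||| t] := nondeg 0 (u *m v) 0.
  - by rewrite mulmx0 mul0mx.
  - by rewrite mulmx0 mul0mx subrr -mulmxA vC mulmx0.
  - by rewrite mulmxA Cu !mul0mx mulmx0 subrr.
  rewrite (scalar_mx_block (k + 1) k t) => /eq_block_mx[_ uv _ _].
  exact: mulmx_cV_rV_eq0 uv u0.
have [E [e [rho [_ CE Ce re _]]]] := pencil_adapted_basis freeC.
have e0 : e != 0.
  apply/eqP => e0; move: re; rewrite e0 mulmx0 => /matrixP/(_ 0 0).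
  by rewrite !mxE => /eqP; rewrite eq_sym oner_eq0.
(* Conjugation by the unipotent [1 N; 0 1] replaces [P] by [P'] and [S] by [0]. *)
pose N := E *m S; have CN : C *m N = S by rewrite mulmxA CE mul1mx.
clearbody N.
pose P' := P + N *m C.
have P'E : P = P' - N *m C by rewrite addrK.
clearbody P'; subst P.
exists (C *m P'); split=> //.
  (* If [v (Q - c C) = 0], any [u] in the kernel of [Q - c C] gives an element of
     the radical of the form, with diagonal blocks [u v C] and [C u v]. *)
  move=> c v vQ; have [u u0 Qu] := wide_mx_kernel (C *m P' - c *: C).
  have {}Qu : C *m P' *m u = c *: (C *m u).
    by move/eqP: Qu; rewrite mulmxBl subr_eq0 -scalemxAl => /eqP.
  pose A0 := u *m (v *m C); pose D0 := C *m u *m v.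
  pose B0 := (P' *m u - c *: u) *m v.
  (* [B0] is the upper right block for the conjugated form; the terms in [N] carry it back to the
     original one. *)
  have [||| t] := nondeg A0 (B0 + A0 *m N - N *m D0) D0.
  - by rewrite /A0 /D0 !mulmxA.
  - rewrite mulmxBl mulmxBr mulmxBl mulmxDl.
    have -> : A0 *m P' = c *: A0.
      by rewrite /A0 -!mulmxA vQ -scalemxAr !mulmxA.
    have -> : B0 *m C = P' *m A0 - c *: A0.
      by rewrite /B0 /A0 -!mulmxA mulmxBl -scalemxAl !mulmxA.
    have -> : A0 *m (N *m C) = A0 *m N *m C by rewrite mulmxA.
    have -> : N *m C *m A0 = N *m D0 *m C by rewrite /A0 /D0 !mulmxA.
    by apply/matrixP => i j; rewrite !mxE; ring.
  - rewrite mulmxBr mulmxDr.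
    have -> : C *m B0 = 0.
      by rewrite /B0 mulmxA mulmxBr mulmxA Qu -scalemxAr subrr mul0mx.
    have -> : C *m (A0 *m N) = D0 *m S by rewrite /A0 /D0 -CN !mulmxA.
    by rewrite mulmxA CN add0r.
  rewrite (scalar_mx_block (k + 1) k t) => /eq_block_mx[A0t _ _ _].
  have t0 : t = 0.
    have : A0 *m e = 0 by rewrite /A0 -!mulmxA Ce !mulmx0.
    rewrite A0t mul_scalar_mx => /eqP; rewrite scaler_eq0 (negbTE e0) orbF.
    by move/eqP.
  have vC : v *m C = 0.
    by apply: mulmx_cV_rV_eq0 u0; rewrite -/A0 A0t t0 raddf0.
  by apply/eqP; rewrite -(mulmx_free_eq0 _ freeC) vC.
(* This is the upper right block of the principal element after the same conjugation; with [S]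
   replaced by 0, its equation becomes [C *m B' = 0]. *)
pose B' := B + N *m D - A *m N.
have CB' : C *m B' = 0.
  rewrite /B' mulmxBr mulmxDr CB !mulmxA CA CN mulmxDl -mulmxA CN.
  by apply/matrixP => i j; rewrite !mxE; ring.
have PA' : P' *m A = A *m P' + P' + B' *m C.
  have : P' *m A = (P' - N *m C) *m A - A *m (P' - N *m C) + N *m (C *m A)
     + A *m P' - A *m N *m C.
    rewrite mulmxBl mulmxBr !mulmxA.
    by apply/matrixP => i j; rewrite !mxE; ring.
  rewrite PA CA mulmxDr /B' mulmxBl mulmxDl -!mulmxA => ->.
  by apply/matrixP => i j; rewrite !mxE; ring.
rewrite -mulmxA PA' !mulmxDr !mulmxA CB' mul0mx addr0 CA mulmxDl mulr2n addrA.
by [].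
Qed.

(** * Duality for the trace form on block upper triangular matrices *)

Lemma dlsubmxB_scalar (K : pzRingType) (p q : nat) (x : 'M[K]_(p + q)) (a : K) :
  dlsubmx (x - a%:M) = dlsubmx x.
Proof. by apply/matrixP => i j; rewrite !mxE eq_rlshift subr0. Qed.

Lemma mxtrace_mul_block_upper (K : pzRingType) (p q : nat) (Z x : 'M[K]_(p + q)) :
  dlsubmx x = 0 ->
  \tr (Z *m x) = \tr (ulsubmx Z *m ulsubmx x) + \tr (dlsubmx Z *m ursubmx x)
               + \tr (drsubmx Z *m drsubmx x).
Proof.
move=> x0; rewrite -{1}[Z]submxK -{1}[x]submxK mulmx_block x0 !mulmx0 addr0.
by rewrite mxtrace_block linearD /= addrA.
Qed.

Lemma mxtrace_mul_scalar_blocks (K : comNzRingType) (p q : nat) (a : K)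
    (Z x : 'M[K]_(p + q)) :
  dlsubmx x = 0 -> \tr x = 0 ->
  ulsubmx Z = a%:M -> drsubmx Z = a%:M -> dlsubmx Z = 0 -> \tr (Z *m x) = 0.
Proof.
move=> x0 trx Zul Zdr Zdl; rewrite mxtrace_mul_block_upper// Zul Zdr Zdl.
rewrite mul0mx mxtrace0 addr0 !mul_scalar_mx !linearZ /= -mulrDr.
by rewrite -(mxtrace_block _ (ursubmx x) (dlsubmx x)) submxK trx mulr0.
Qed.

(** Subtracting the scalar [\tr Z / n] from [Z] extends the orthogonality from traceless [x] to all
    block upper triangular [x]; elementary matrices then read off the entries. The upper right block
    of [Z] stays free because it pairs with the zero block of [x]. *)
Lemma trace_form_orthogonal (K : numFieldType) (p q : nat) (Z : 'M[K]_(p + q)) :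
  (0 < p + q)%N ->
  (forall x : 'M[K]_(p + q), dlsubmx x = 0 -> \tr x = 0 -> \tr (Z *m x) = 0) ->
  exists a : K, [/\ ulsubmx Z = a%:M, drsubmx Z = a%:M & dlsubmx Z = 0].
Proof.
move=> n_gt0 orthZ; pose n := (p + q)%N; pose a := \tr Z / n%:R; exists a.
have n0 : n%:R != 0 :> K by rewrite pnatr_eq0 -lt0n.
have orthZa x : dlsubmx x = 0 -> \tr ((Z - a%:M) *m x) = 0.
  move=> x0; pose t := \tr x / n%:R.
  rewrite -[RHS](orthZ (x - t%:M)).
  - rewrite mulmxBl mulmxBr !linearB /= mul_scalar_mx mul_mx_scalar !linearZ /=.
    by rewrite /a /t mulrAC [\tr Z * _]mulrC mulrAC.
  - by rewrite dlsubmxB_scalar.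
  - by rewrite linearB /= mxtrace_scalar -[t *+ _]mulr_natr /t divfK// subrr.
have entry (i j : 'I_(p + q)) :
    dlsubmx (delta_mx j i : 'M[K]_(p + q)) = 0 -> Z i j = a%:M i j.
  move=> /orthZa; rewrite -(mul_delta_mx (0 : 'I_1)) mulmxA mxtrace_mulC mulmxA.
  rewrite -rowE -colE trace_mx11 !mxE => /eqP.
  by rewrite subr_eq0 => /eqP.
have dl0 (i j : 'I_(p + q)) : (j < p)%N || (p <= i)%N ->
    dlsubmx (delta_mx j i : 'M[K]_(p + q)) = 0.
  move=> ij; apply/matrixP => i' j'; rewrite !mxE -!val_eqE /=.
  case: eqP => //= jE; case: eqP => //= iE; case/orP: ij => ij.
    by move: ij; rewrite -jE ltnNge leq_addr.
  by move: ij; rewrite -iE leqNgt ltn_ord.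
split; apply/matrixP => i j; rewrite [LHS]mxE [LHS]mxE.
- rewrite entry; first by rewrite !mxE (inj_eq (@lshift_inj _ _)).
  by apply: dl0; rewrite /= ltn_ord.
- rewrite entry; first by rewrite !mxE (inj_eq (@rshift_inj _ _)).
  by apply: dl0; rewrite /= leq_addr orbT.
- rewrite entry; first by rewrite !mxE eq_rlshift.
  by apply: dl0; rewrite /= ltn_ord.
Qed.

Lemma mxtrace_mul_commutator (K : comNzRingType) (n : nat) (M x y : 'M[K]_n) :
  \tr (M *m (x *m y - y *m x)) = \tr ((M *m x - x *m M) *m y).
Proof.
rewrite mulmxBr mulmxBl !linearB /= !mulmxA; congr (_ - _).
by rewrite mxtrace_mulC mulmxA.
Qed.

Lemma commutator_block_upper (K : comPzRingType) (p q : nat) (P A : 'M[K]_p)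
    (Y B : 'M[K]_(p, q)) (C : 'M[K]_(q, p)) (S D : 'M[K]_q) :
  block_mx P Y C S *m block_mx A B 0 D - block_mx A B 0 D *m block_mx P Y C S
  = block_mx (P *m A - A *m P - B *m C)
      (P *m B + Y *m D - A *m Y - B *m S)
      (C *m A - D *m C) (C *m B + S *m D - D *m S).
Proof.
rewrite !mulmx_block !mul0mx !mulmx0 !addr0 !add0r opp_block_mx add_block_mx.
by rewrite !opprD !addrA.
Qed.

(** By cyclicity of the trace, the condition on [w] says that [[M, w] - M] is orthogonal to the
    parabolic. Its blocks give the equations of [pencil_of_form] up to a scalar [l]. *)
Lemma principal_char_poly (K : numClosedFieldType) (k : nat)
    (M w : 'M[K]_(k + 1 + k)) :
  dlsubmx w = 0 ->
  (forall x, dlsubmx x = 0 -> \tr x = 0 ->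
     (forall y, dlsubmx y = 0 -> \tr y = 0 ->
        \tr (M *m (x *m y - y *m x)) = 0) -> x = 0) ->
  (forall x, dlsubmx x = 0 -> \tr x = 0 ->
     \tr (M *m (w *m x - x *m w)) = \tr (M *m x)) ->
  exists a : K,
    char_poly (ulsubmx w) = \prod_(i < k.+1) ('X - (a - i%:R)%:P) /\
    char_poly (drsubmx w) = \prod_(i < k) ('X - (a - 2%:R - i%:R)%:P).
Proof.
move=> w0 frobM princ.
have n_gt0 : (0 < k + 1 + k)%N by rewrite addn1.
have [l [Zul Zdr Zdl]] : exists l : K,
    [/\ ulsubmx (M *m w - w *m M - M) = l%:M,
        drsubmx (M *m w - w *m M - M) = l%:M
      & dlsubmx (M *m w - w *m M - M) = 0].
  apply: trace_form_orthogonal => // x x0 trx.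
  by rewrite mulmxBl linearB /= -mxtrace_mul_commutator princ// subrr.
have [P [Y [C [S ME]]]] : exists P Y C S, M = block_mx P Y C S.
  by exists (ulsubmx M), (ursubmx M), (dlsubmx M), (drsubmx M); rewrite submxK.
have [A [B [D wE]]] : exists A B D, w = block_mx A B 0 D.
  by exists (ulsubmx w), (ursubmx w), (drsubmx w); rewrite -w0 submxK.
subst M w; rewrite block_mxKul block_mxKdr.
move: Zul Zdr Zdl; rewrite commutator_block_upper opp_block_mx add_block_mx.
rewrite block_mxKul block_mxKdr block_mxKdl => Zul Zdr Zdl.
(* Adding [l] to [M] does not change the functional on traceless matrices. Replacing [P] and [S] by
   [P + l] and [S + l] therefore absorbs the scalar, without affecting commutators. *)
have Pl X : (P + l%:M) *m X - X *m (P + l%:M) = P *m X - X *m P.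
  by rewrite mulmxDl mulmxDr mul_scalar_mx mul_mx_scalar opprD addrACA subrr addr0.
have Sl X : X *m (S + l%:M) - (S + l%:M) *m X = X *m S - S *m X.
  by rewrite mulmxDl mulmxDr mul_scalar_mx mul_mx_scalar opprD addrACA subrr addr0.
have nondeg (A0 : 'M_(k + 1)) (B0 : 'M_(k + 1, k)) (D0 : 'M_k) :
    C *m A0 = D0 *m C ->
    (P + l%:M) *m A0 - A0 *m (P + l%:M) = B0 *m C ->
    C *m B0 = D0 *m (S + l%:M) - (S + l%:M) *m D0 ->
    exists t : K, block_mx A0 B0 0 D0 = t%:M.
  rewrite Pl Sl => CA0 PA0 CB0; set x := block_mx A0 B0 0 D0.
  (* [frobM] speaks of traceless matrices only, so it is applied to [x - t], which has the same
     commutator with [M]. *)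
  pose t := \tr x / (k + 1 + k)%:R; exists t.
  apply/eqP; rewrite -subr_eq0; apply/eqP.
  have n0 : (k + 1 + k)%:R != 0 :> K by rewrite pnatr_eq0 -lt0n.
  apply: frobM => [||y y0 try].
  - by rewrite dlsubmxB_scalar block_mxKdl.
  - by rewrite linearB /= mxtrace_scalar -[t *+ _]mulr_natr /t divfK ?subrr.
  rewrite mxtrace_mul_commutator mulmxBr [(x - _) *m _]mulmxBl.
  rewrite mul_scalar_mx mul_mx_scalar opprB addrA subrK commutator_block_upper.
  apply: (@mxtrace_mul_scalar_blocks _ _ _ 0) => //.
  - by rewrite block_mxKul PA0 subrr raddf0.
  - by rewrite block_mxKdr CB0 subrK subrr raddf0.
  - by rewrite block_mxKdl CA0 subrr.
have CA : C *m A = D *m C + C.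
  by rewrite addrC; apply/eqP; rewrite -subr_eq -subr_eq0 Zdl.
have PA : (P + l%:M) *m A - A *m (P + l%:M) = B *m C + (P + l%:M).
  by rewrite Pl -Zul; apply/matrixP => i j; rewrite !mxE; ring.
have CB : C *m B = D *m (S + l%:M) - (S + l%:M) *m D + (S + l%:M).
  by rewrite Sl -Zdr; apply/matrixP => i j; rewrite !mxE; ring.
have [Q [freeC noeig QA]] := pencil_of_form nondeg CA PA CB.
exact: pencil_char_poly freeC noeig CA QA.
Qed.

(** * Sylvester operators *)

Lemma char_poly_diag (K : comNzRingType) (n : nat) (d : 'rV[K]_n) :
  char_poly (diag_mx d) = \prod_(i < n) ('X - (d 0 i)%:P).
Proof.
rewrite char_poly_trig; last by rewrite is_diag_mx_is_trig ?diag_mx_is_diag.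
by apply: eq_bigr => i _; rewrite mxE eqxx mulr1n.
Qed.

(** The minimal polynomial divides the characteristic one, which here splits with distinct roots. *)
Lemma diagonalize_simple_roots (K : fieldType) (n : nat) (A : 'M[K]_n)
    (rs : seq K) :
  char_poly A = \prod_(x <- rs) ('X - x%:P) -> uniq rs ->
  exists (G : 'M[K]_n) (d : 'rV[K]_n),
    [/\ G \in unitmx, G *m A = diag_mx d *m G
      & perm_eq [seq d 0 i | i : 'I_n] rs].
Proof.
move=> cpA rs_uniq.
have [G [d [uG GA]]] : exists (G : 'M[K]_n) (d : 'rV[K]_n),
    G \in unitmx /\ G *m A = diag_mx d *m G.
  case: n A cpA => [|n] A cpA.
    by exists 1%:M, 0; rewrite unitmx1 [LHS]flatmx0 [RHS]flatmx0.
  have /diagonalizableP[G uG /diagonalizable_forPex[d]] : exists2 rs, uniq rs &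
      mxminpoly A %| \prod_(x <- rs) ('X - x%:P).
    by exists rs => //; rewrite -cpA mxminpoly_dvd_char.
  by move=> /(simmxP uG); exists G, d.
exists G, d; split=> //; apply: prod_XsubC_eq.
by rewrite -cpA (char_poly_conj uG GA) char_poly_diag big_image.
Qed.

Lemma mxvec_ext (K : pzRingType) (m n p : nat) (M N : 'M[K]_(m * n, p)) :
  (forall x : 'M[K]_(m, n), mxvec x *m M = mxvec x *m N) -> M = N.
Proof.
move=> MN; apply/row_matrixP => i; rewrite !rowE.
by rewrite -[delta_mx 0 i]vec_mxK MN.
Qed.

Definition sylvester (K : comPzRingType) (m n : nat) (A : 'M[K]_m)
    (D : 'M[K]_n) : 'M[K]_(m * n) := lin_mulmx A - lin_mulmxr D.

Lemma mxvec_sylvester (K : comPzRingType) (m n : nat) (A : 'M[K]_m)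
    (D : 'M[K]_n) (x : 'M[K]_(m, n)) :
  mxvec x *m sylvester A D = mxvec (A *m x - x *m D).
Proof. by rewrite mulmxBr !mul_vec_lin linearB. Qed.

(** Both matrices are diagonalizable, and [x |-> invmx G *m x *m H] intertwines the operator with
    the one for their diagonal forms. The elementary matrices are eigenvectors of the latter, with
    the differences as eigenvalues. *)
Lemma char_poly_sylvester (K : fieldType) (m n : nat) (A : 'M[K]_m)
    (D : 'M[K]_n) (rs ss : seq K) :
  char_poly A = \prod_(x <- rs) ('X - x%:P) -> uniq rs ->
  char_poly D = \prod_(x <- ss) ('X - x%:P) -> uniq ss ->
  char_poly (sylvester A D) = \prod_(z <- [seq x - y | x <- rs, y <- ss]) ('X - z%:P).
Proof.
move=> cA uA cD uD.
have [G [a [uG GA rsE]]] := diagonalize_simple_roots cA uA.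
have [H [d [uH HD ssE]]] := diagonalize_simple_roots cD uD.
have [J vecJ] : exists J : 'M[K]_(m * n),
    forall x, mxvec x *m J = mxvec (invmx G *m x *m H).
  exists (lin_mulmx (invmx G) *m lin_mulmxr H) => x.
  by rewrite mulmxA !mul_vec_lin.
have uJ : J \in unitmx.
  apply: (proj1 (@mulmx1_unit _ _ _ (lin_mulmx G *m lin_mulmxr (invmx H)) _)).
  apply: mxvec_ext => x; rewrite mulmx1 mulmxA vecJ mulmxA !mul_vec_lin /=.
  by rewrite !mulmxA mulmxV// mul1mx mulmxK.
have AG : A *m invmx G = invmx G *m diag_mx a.
  by rewrite -[LHS]mul1mx -(mulVmx uG) -mulmxA [G *m _]mulmxA GA mulmxK.
rewrite (@char_poly_conj _ _ _ (sylvester (diag_mx a) (diag_mx d)) J uJ); last first.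
  apply: mxvec_ext => x; rewrite !mulmxA vecJ !mxvec_sylvester vecJ.
  rewrite mulmxBr mulmxBl !mulmxA AG; congr (mxvec (_ - _)).
  by rewrite -!mulmxA HD.
have -> : sylvester (diag_mx a) (diag_mx d)
    = diag_mx (mxvec (\matrix_(i, j) (a 0 i - d 0 j))).
  apply: mxvec_ext => x; rewrite mxvec_sylvester.
  apply/rowP => l; case/mxvec_indexP: l => i j.
  rewrite (mul_mx_diag (mxvec x)) [RHS]mxE !mxvecE mul_diag_mx mul_mx_diag.
  by rewrite !mxE; ring.
rewrite char_poly_diag (reindex _ (curry_mxvec_bij _ _)) /=.
transitivity (\prod_(p : 'I_m * 'I_n) ('X - (a 0 p.1 - d 0 p.2)%:P)).
  by apply: eq_bigr => -[i j] _ /=; rewrite mxvecE mxE.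
rewrite big_allpairs_dep /=.
rewrite -(pair_big xpredT xpredT (fun i j => 'X - (a 0 i - d 0 j)%:P)) /=.
rewrite -(perm_big _ rsE) big_image /=; apply: eq_bigr => i _.
by rewrite -(perm_big _ ssE) big_image.
Qed.

(** * The adjoint action on the seaweed *)

(* [phi] identifies [V] with a complement of the line spanned by [z], on which
   [M] acts as zero. *)
Lemma char_poly_extend_kernel (K : fieldType) (V : vectType K) (N : nat)
    (phi : {linear V -> 'rV[K]_N}) (z : 'rV[K]_N) (f : 'End(V)) (M : 'M[K]_N)
    (e : (\dim {:V}).-tuple V) :
  basis_of {:V} e ->
  (forall v, phi (f v) = phi v *m M) -> z *m M = 0 ->
  (forall v c, phi v + c *: z = 0 -> v = 0 /\ c = 0) ->
  (forall u, exists v c, u = phi v + c *: z) ->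
  char_poly M = char_poly (mxof e e f) * 'X.
Proof.
move=> eb phif zM inj_phi surj_phi.
pose T := col_mx (lin1_mx (phi \o vecof e)) z.
have TE u : u *m T = phi (vecof e (lsubmx u)) + rsubmx u 0 0 *: z.
  rewrite -{1}[u]hsubmxK mul_row_col mul_rV_lin1 /=.
  by rewrite {1}[rsubmx u]mx11_scalar mul_scalar_mx.
clearbody T.
have freeT : row_free T.
  rewrite -kermx_eq0; apply/rowV0P => u /sub_kermxP; rewrite TE => /inj_phi[u1 u2].
  rewrite -[u]hsubmxK [rsubmx u]mx11_scalar u2 raddf0.
  move/eqP: u1; rewrite (vecof_eq0 eb) => /eqP ->.
  by rewrite row_mx0.
have fullT : row_full T.
  rewrite -sub1mx; apply/row_subP => i; apply/submxP.
  have [v [c ->]] := surj_phi (row i 1%:M).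
  exists (row_mx (rVof e v) c%:M); rewrite TE row_mxKl row_mxKr (rVofK eb).
  by rewrite mxE eqxx mulr1n.
(* The rows of [T] are both independent and spanning, so [T] is square and serves as a change of
   basis. *)
have NE : N = (\dim {:V} + 1)%N by rewrite -(eqP freeT) (eqP fullT).
clear inj_phi surj_phi; subst N.
rewrite row_free_unit in freeT.
rewrite (@char_poly_conj _ _ M (block_mx (mxof e e f) 0 0 (0 : 'M_1)) T)//.
  rewrite char_poly_lblock; congr (_ * _).
  rewrite char_poly_trig; last by apply/is_trig_mxP => *; rewrite mxE.
  by rewrite big_ord1 mxE subr0.
apply/eqP/mulmxP => u; rewrite !mulmxA TE mulmxDl -scalemxAl zM scaler0 addr0.
rewrite -phif (hom_vecof e eb) -{2}[u]hsubmxK TE mul_row_block !mulmx0 !addr0.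
by rewrite row_mxKl row_mxKr mxE scale0r addr0.
Qed.

Lemma span_delta_mxP (K : fieldType) (n : nat) (S : pred 'I_n) (v : 'cV[K]_n) :
  reflect (forall i, ~~ S i -> v i 0 = 0)
    (v \in <<[seq delta_mx i 0%R | i : 'I_n <- enum 'I_n & S i]>>%VS).
Proof.
set s := [seq _ | _ <- _]; apply: (iffP idP) => [|v0].
  move=> /(@coord_span _ _ _ (in_tuple s)) -> i Si.
  rewrite summxE big1// => l _; rewrite mxE.
  have /mapP[j] : (in_tuple s)`_l \in s by rewrite mem_nth.
  rewrite mem_filter => /andP[Sj _] ->; rewrite mxE eqxx andbT.
  by case: eqP => [ij|]; rewrite ?mulr0//; rewrite ij Sj in Si.
rewrite [v]matrix_sum_delta memv_suml// => i _; rewrite big_ord1.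
have [Si|/v0 ->] := boolP (S i); last by rewrite scale0r mem0v.
apply/memvZ/memv_span/mapP; exists i => //.
by rewrite mem_filter Si mem_enum.
Qed.

(** Only the span of the first [p] basis vectors imposes a condition; every other member of the two
    flags is 0 or the whole space. *)
Lemma mem_parabolicP (K : fieldType) (p q : nat) (x : 'M[K]_(p + q)) :
  reflect (\tr x = 0 /\ dlsubmx x = 0)
    (x \in seaweed_space K (p + q) [:: p; q] [:: (p + q)%N]).
Proof.
have headE i (v : 'cV[K]_(p + q)) : v \in head_space K (p + q) [:: p; q] i <->
    (forall j : 'I_(p + q), (sumn (take i [:: p; q]) <= j)%N -> v j 0 = 0).
  split=> [/span_delta_mxP v0 j le_j|v0]; first by apply: v0; rewrite -leqNgt.
  by apply/span_delta_mxP => j; rewrite -leqNgt; exact: v0.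
have tailE i (v : 'cV[K]_(p + q)) : v \in tail_space K (p + q) [:: (p + q)%N] i <->
    (forall j : 'I_(p + q), (j < sumn (take i [:: (p + q)%N]))%N -> v j 0 = 0).
  split=> [/span_delta_mxP v0 j lt_j|v0]; first by apply: v0; rewrite -ltnNge.
  by apply/span_delta_mxP => j; rewrite -ltnNge; exact: v0.
apply: (iffP (seaweed_spaceP _ _ _)) => [[trx xh _]|[trx x0]]; split=> //.
- apply/matrixP => i j; rewrite !mxE.
  have /headE/(_ (rshift p i)) : x *m delta_mx (lshift q j) 0
      \in head_space K (p + q) [:: p; q] 1.
    apply: (xh 1%N) => //; apply/headE => l /=; rewrite addn0 => le_pl.
    rewrite mxE eqxx andbT; case: eqP => //= lE.
    by move: le_pl; rewrite lE leqNgt /= ltn_ord.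
  by rewrite -colE mxE /= addn0 leq_addr => ->.
- move=> i le_i v vh; apply/headE; move: vh => /headE.
  case: i le_i => [|[|[|//]]] _ /= v0 j le_j.
  + have -> : v = 0 by apply/matrixP => l l'; rewrite ord1 v0 ?mxE.
    by rewrite mulmx0 mxE.
  + rewrite addn0 in le_j v0; rewrite mxE big1// => l _.
    case: (split_ordP l) => l' ->; last by rewrite v0 ?mulr0 /= ?leq_addr.
    case: (split_ordP j) le_j => j' -> /= le_j.
      by rewrite leqNgt ltn_ord in le_j.
    by have /matrixP/(_ j' l') := x0; rewrite !mxE => ->; rewrite mul0r.
  + by move: le_j; rewrite addn0 leqNgt ltn_ord.
- move=> i le_i v vh; apply/tailE; move: vh => /tailE.
  case: i le_i => [|[|//]] _ //= v0 j _.
  have -> : v = 0 by apply/matrixP => l l'; rewrite ord1 v0 ?mxE// addn0 ltn_ord.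
  by rewrite mulmx0 mxE.
Qed.

(** The upper right block, an ideal of the parabolic, comes first, so that the adjoint action
    becomes block lower triangular on row vectors. The lower left block is dropped, being 0 on the
    parabolic. *)
Definition block_row (K : pzRingType) (p q : nat) (x : 'M[K]_(p + q)) :
    'rV[K]_(p * q + (p * p + q * q)) :=
  row_mx (mxvec (ursubmx x)) (row_mx (mxvec (ulsubmx x)) (mxvec (drsubmx x))).

Lemma block_row_linear (K : pzRingType) (p q : nat) : linear (@block_row K p q).
Proof.
move=> c x y; rewrite /block_row !scale_row_mx !add_row_mx -!linearP /=.
by do ![congr row_mx]; congr mxvec; apply/matrixP => i j; rewrite !mxE.
Qed.

HB.instance Definition _ (K : pzRingType) (p q : nat) :=
  GRing.isSemilinear.Build K _ _ _ (@block_row K p q)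
    (GRing.semilinear_linear (@block_row_linear K p q)).

Lemma block_row_eq0 (K : pzRingType) (p q : nat) (x : 'M[K]_(p + q)) :
  dlsubmx x = 0 -> block_row x = 0 -> x = 0.
Proof.
move=> x0; rewrite /block_row -[RHS]row_mx0 => /eq_row_mx[ur].
rewrite -[RHS]row_mx0 => /eq_row_mx[ul dr].
rewrite -[x]submxK x0 -[ursubmx x]mxvecK ur -[ulsubmx x]mxvecK ul.
by rewrite -[drsubmx x]mxvecK dr !linear0 block_mx_const.
Qed.

Definition parabolic_ad_mx (K : comPzRingType) (p q : nat) (w : 'M[K]_(p + q)) :
    'M[K]_(p * q + (p * p + q * q)) :=
  block_mx (sylvester (ulsubmx w) (drsubmx w)) 0
    (col_mx (lin_mulmxr (- ursubmx w)) (lin_mulmx (ursubmx w)))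
    (block_mx (sylvester (ulsubmx w) (ulsubmx w)) 0
              0 (sylvester (drsubmx w) (drsubmx w))).

Lemma block_row_commutator (K : comPzRingType) (p q : nat) (w x : 'M[K]_(p + q)) :
  dlsubmx w = 0 -> dlsubmx x = 0 ->
  block_row (w *m x - x *m w) = block_row x *m parabolic_ad_mx w.
Proof.
move=> w0 x0; rewrite -{1 2}[w]submxK -{1 2}[x]submxK w0 x0.
rewrite !mulmx_block !mul0mx !mulmx0 !addr0 !add0r opp_block_mx add_block_mx.
rewrite /block_row /parabolic_ad_mx !block_mxKul !block_mxKur !block_mxKdr.
rewrite !mul_row_block !mul_row_col !mulmx0 !addr0 !add0r !mxvec_sylvester.
rewrite !mul_vec_lin /= -!linearD /=; congr (row_mx (mxvec _) _).
by rewrite mulmxN; apply/matrixP => i j; rewrite !mxE; ring.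
Qed.

(** The block upper triangular matrices are the seaweed plus the scalars, on which [ad w] vanishes;
    this accounts for the factor ['X]. *)
Lemma char_poly_parabolic_ad (K : numClosedFieldType) (p q : nat)
    (w : seaweed K (p + q) [:: p; q] [:: (p + q)%N]) :
  (0 < p + q)%N ->
  let e := vbasis {: seaweed K (p + q) [:: p; q] [:: (p + q)%N]} in
  char_poly (parabolic_ad_mx (vsval w)) = char_poly (mxof e e (ad w)) * 'X.
Proof.
move=> n_gt0; set V := seaweed _ _ _ _ => e.
have upper (v : V) : \tr (vsval v) = 0 /\ dlsubmx (vsval v) = 0.
  exact/mem_parabolicP/subvsP.
have n0 : (p + q)%:R != 0 :> K by rewrite pnatr_eq0 -lt0n.
pose phi : {linear V -> 'rV[K]_(p * q + (p * p + q * q))} := @block_row K p q \o vsval.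
apply: (@char_poly_extend_kernel _ _ _ phi (block_row 1%:M)) => //.
- exact: vbasisP.
- move=> v; rewrite lfunE /= -block_row_commutator ?(upper _).2//.
- rewrite -block_row_commutator ?(upper _).2//.
    by rewrite mulmx1 mul1mx subrr linear0.
  by apply/matrixP => i j; rewrite !mxE eq_rlshift.
- move=> v c; rewrite /= -linearZ -linearD /= => /block_row_eq0 vc0.
  have {}vc0 : vsval v + c *: 1%:M = 0.
    apply: vc0; rewrite -(dlsubmxB_scalar _ c) scalemx1 addrK.
    exact: (upper _).2.
  have c0 : c = 0.
    have := congr1 mxtrace vc0; rewrite linearD linearZ /= mxtrace0 (upper v).1.
    rewrite mxtrace1 add0r => /eqP; rewrite mulf_eq0 (negbTE n0) orbF.
    by move/eqP.
  split=> //; apply: val_inj; rewrite /=.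
  by move: vc0; rewrite c0 scale0r addr0.
move=> u.
pose x : 'M[K]_(p + q) := block_mx (vec_mx (lsubmx (rsubmx u)))
  (vec_mx (lsubmx u)) 0 (vec_mx (rsubmx (rsubmx u))).
pose t := \tr x / (p + q)%:R.
have xt : x - t%:M \in seaweed_space K (p + q) [:: p; q] [:: (p + q)%N].
  apply/mem_parabolicP; rewrite dlsubmxB_scalar block_mxKdl; split=> //.
  by rewrite linearB /= mxtrace_scalar -[t *+ _]mulr_natr /t divfK ?subrr.
exists (Subvs xt), t; rewrite /= -linearZ -linearD /= scalemx1 subrK /block_row.
by rewrite block_mxKur block_mxKul block_mxKdr !vec_mxK !hsubmxK.
Qed.

(** * Counting differences *)

Definition diff_count (p q : nat) (z : int) : nat :=
  (\sum_(0 <= i < p) \sum_(0 <= j < q) (i%:Z - j%:Z == z)%R)%N.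

(** This counts the points of a diagonal in a [p] by [q] rectangle; truncated subtraction gives 0
    when the diagonal misses it. *)
Lemma diff_countE (p q : nat) (z : int) :
  diff_count p q z =
  if (0 <= z)%R then minn q (p - `|z|) else minn p (q - `|z|).
Proof.
have inner i : (\sum_(0 <= j < q) (i%:Z - j%:Z == z)%R)%N
    = (0 <= i%:Z - z < q%:Z)%R :> nat.
  elim: q => [|q IH]; first by rewrite big_geq//; lia.
  by rewrite big_nat_recr//= IH; lia.
rewrite /diff_count; elim: p => [|p IH]; first by rewrite big_geq//; case: ifP; lia.
by rewrite big_nat_recr//= IH inner; do 2?case: ifP; lia.
Qed.

Lemma count_allpairs (S T : Type) (R : eqType) (f : S -> T -> R) (s : seq S)
    (t : seq T) (z : R) :
  count_mem z [seq f x y | x <- s, y <- t]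
  = (\sum_(x <- s) \sum_(y <- t) (f x y == z))%N.
Proof.
elim: s => [|x s IH]; first by rewrite big_nil.
rewrite big_cons -IH /= count_cat; congr addn.
by rewrite count_map -sum1_count big_mkcond; apply: eq_bigr => y _ /=; case: eqP.
Qed.

(** For [k = 1] the flattened part is empty and [3 * k - 1 = 2], so one list serves both cases of
    the theorem. *)
Definition spectrum_seq (k : nat) : seq int :=
  (nseq 1 (- k%:Z) ++ nseq (3 * k - 1) 0 ++ nseq (3 * k - 1) 1
   ++ nseq 1 (k%:Z + 1)) ++
  flatten [seq nseq (3 * i) (- k%:Z + i%:Z) ++ nseq (3 * i) (k%:Z - i%:Z + 1)
          | i <- index_iota 1 k].

(** The right side lists the differences on the upper right, upper left and lower right blocks; the
    added 0 is the eigenvalue on the scalars. Multiplicities are compared integer by integer. *)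
Lemma perm_spectrum_seq (k : nat) : (0 < k)%N ->
  perm_eq (0 :: spectrum_seq k)
    ([seq 2%:Z + j%:Z - i%:Z | i <- iota 0 k.+1, j <- iota 0 k]
     ++ [seq j%:Z - i%:Z | i <- iota 0 k.+1, j <- iota 0 k.+1]
     ++ [seq j%:Z - i%:Z | i <- iota 0 k, j <- iota 0 k]).
Proof.
move=> k_gt0; set s1 := _ :: _; set s2 := _ ++ _.
suff cnt (z : int) : count_mem z s1 = count_mem z s2.
  by apply/allP => z _; apply/eqP/cnt.
have [k1 k1E] : exists k1, k1 = k.+1 by exists k.+1.
rewrite /s1 /s2 -cat1s -k1E.
rewrite !count_cat !count_allpairs !count_nseq count_flatten -map_comp.
have cntE p q : (\sum_(x <- iota 0 p) \sum_(y <- iota 0 q)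
    (y%:Z - x%:Z == z)%R)%N = diff_count p q (- z).
  rewrite /diff_count /index_iota !subn0.
  by do 2!apply: eq_bigr => ? _; congr nat_of_bool; lia.
have cnt2E p q : (\sum_(x <- iota 0 p) \sum_(y <- iota 0 q)
    (2%:Z + y%:Z - x%:Z == z)%R)%N = diff_count p q (2%:Z - z).
  rewrite /diff_count /index_iota !subn0.
  by do 2!apply: eq_bigr => ? _; congr nat_of_bool; lia.
rewrite !cntE cnt2E.
have sumE (t : int) m : (\sum_(1 <= i < m) 3 * i * (i%:Z == t))%N
   = if (1 <= t)%R && (t < m%:Z)%R then (3 * `|t|)%N else 0%N.
  elim: m => [|m IH]; first by rewrite big_geq//; case: ifP => //; lia.
  have [->|m_gt0] := posnP m; first by rewrite big_geq//; case: ifP => //; lia.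
  by rewrite big_nat_recr//= IH; do 2!case: ifP; lia.
rewrite sumnE big_map.
transitivity ((0 == z)%R + (- k%:Z == z)%R + (3 * k - 1) * (0 == z)%R
   + (3 * k - 1) * (1 == z)%R + (k%:Z + 1 == z)%R
   + (\sum_(1 <= i < k) 3 * i * (i%:Z == z + k%:Z)%R
   + \sum_(1 <= i < k) 3 * i * (i%:Z == k%:Z + 1 - z)%R))%N.
  rewrite -big_split /=; set s3 := (X in (_ + (_ + X))%N); set s4 := (X in _ = (_ + X)%N).
  have -> : s3 = s4.
    apply: eq_bigr => i _; rewrite count_cat !count_nseq /=.
    have -> : (- k%:Z + i%:Z == z) = (i%:Z == z + k%:Z) by lia.
    have -> : (k%:Z - i%:Z + 1 == z) = (i%:Z == k%:Z + 1 - z) by lia.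
    by rewrite ![(nat_of_bool _ * _)%N]mulnC.
  by lia.
rewrite !sumE.
(* Each of the two sums has at most one nonzero term, at [i = z + k] or [i = k + 1 - z]. The second
   index is out of range for [z <= 0], the first for [z > 0]. *)
have [le_z0|gt_z0] := lerP z 0.
  have [m zE] : exists m : nat, z = - m%:Z by exists `|z|%N; lia.
  subst z; clear -k_gt0 k1E.
  have -> : 2%:Z - - m%:Z = m.+2%:Z by lia.
  rewrite opprK !diff_countE /=.
  have -> : (1 <= k%:Z + 1 + m%:Z < k%:Z) = false by lia.
  have -> : (1 == - m%:Z) = false by lia.
  have -> : (k%:Z + 1 == - m%:Z) = false by lia.
  have -> : (0 == - m%:Z) = (m == 0)%N by lia.
  have -> : (- k%:Z == - m%:Z) = (k == m) by lia.
  case: ifP => km.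
    have -> : absz (- m%:Z + k%:Z)%R = (k - m)%N by lia.
    have -> : (k == m) = false by lia.
    case: (m =P 0)%N; lia.
  case: (m =P 0)%N => m0; case: (k =P m) => mk; lia.
have [m zE] : exists m : nat, z = m.+1%:Z by exists `|z - 1|%N; lia.
subst z; clear -k_gt0 k1E.
have diffN p q : diff_count p q (- m.+1%:Z) = minn p (q - m.+1).
  by rewrite diff_countE; case: ifP; lia.
rewrite !diffN {diffN}.
have -> : (1 <= m.+1%:Z + k%:Z < k%:Z) = false by lia.
have -> : (1 == m.+1%:Z) = (m == 0)%N by lia.
have -> : (k%:Z + 1 == m.+1%:Z) = (k == m) by lia.
have -> : (0 == m.+1%:Z) = false by lia.
have -> : (- k%:Z == m.+1%:Z) = false by lia.
(* The shift by 2 makes [2 - z] positive at [z = 1] but nonpositive from [z = 2] on, so [m = 0] is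
   separated. *)
have -> : diff_count k1 k (2%:Z - m.+1%:Z)
    = if m is m'.+1 then minn k1 (k - m') else minn k (k1 - 1).
  by rewrite diff_countE; case: m => [|m]; case: ifP; lia.
case: ifP => km.
  have -> : absz (k%:Z + 1 - m.+1%:Z)%R = (k - m)%N by lia.
  have -> : (k == m) = false by lia.
  case: m km => [|m]; lia.
by case: m km => [|m]; case: (k =P _) => mk; lia.
Qed.

(** * Eigenvalue multisets and the spectrum of a principal element *)

Lemma seq_mset_cat (T : choiceType) (s t : seq T) :
  seq_mset (s ++ t) = (seq_mset s `+` seq_mset t)%mset.
Proof. by apply/msetP => x; rewrite msetE2 !mset_seqE count_cat. Qed.

Lemma seq_mset_nseq (T : choiceType) (n : nat) (x : T) :
  seq_mset (nseq n x) = msetn n x.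
Proof. by rewrite -enum_msetn seq_mset_id. Qed.

Lemma seq_mset_flatten (T : choiceType) (I : Type) (f : I -> seq T) (r : seq I) :
  seq_mset (flatten [seq f i | i <- r]) = \big[msetD/mset0]_(i <- r) seq_mset (f i).
Proof.
elim: r => [|i r IH].
  by rewrite big_nil; apply/msetP => x; rewrite mset_seqE mset0E.
by rewrite /= seq_mset_cat IH big_cons.
Qed.

Lemma spectrum_seq_mset (K : numDomainType) (k : nat) : (0 < k)%N ->
  (if k == 1%N then
     msetn 1%N (-1) `+` msetn 2%N 0 `+` msetn 2%N 1 `+` msetn 1%N 2%:R
   else
     (msetn 1%N (- k%:R) `+` msetn (3 * k - 1)%N 0 `+` msetn (3 * k - 1)%N 1
      `+` msetn 1%N (k%:R + 1))
     `+` \big[msetD/mset0]_(1 <= i < k)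
           (msetn (3 * i)%N (- k%:R + i%:R)
            `+` msetn (3 * i)%N (k%:R - i%:R + 1)))%mset
  = seq_mset [seq z%:~R | z <- spectrum_seq k] :> {mset K}%mset.
Proof.
move=> k_gt0; rewrite /spectrum_seq !map_cat !map_nseq map_flatten -map_comp.
rewrite !seq_mset_cat !seq_mset_nseq seq_mset_flatten !msetDA.
rewrite rmorphN rmorphD rmorph0 rmorph1 /= -pmulrn.
case: eqP => [->|_].
  by rewrite big_geq// msetD0 natr1.
congr (_ `+` _)%mset; apply: eq_bigr => i _.
rewrite /= map_cat !map_nseq seq_mset_cat !seq_mset_nseq.
by rewrite !rmorphD !rmorphN rmorph1 /= -!pmulrn.
Qed.

Lemma principal_spectrum (K : numClosedFieldType) (k : nat)
    (F : 'Hom(seaweed K (k + 1 + k) [:: k + 1; k]%N [:: (k + 1 + k)%N], K^o))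
    (w : seaweed K (k + 1 + k) [:: k + 1; k]%N [:: (k + 1 + k)%N]) :
  (0 < k)%N -> frobenius_functional F -> principal_element F w ->
  eigenvalue_mset (ad w) = seq_mset [seq z%:~R | z <- spectrum_seq k].
Proof.
move=> k_gt0; set V := seaweed _ _ _ _ in F w * => frobF princF.
have n_gt0 : (0 < k + 1 + k)%N by rewrite addn1.
have upper (v : V) : \tr (vsval v) = 0 /\ dlsubmx (vsval v) = 0.
  exact/mem_parabolicP/subvsP.
have lift (x : 'M_(k + 1 + k)) : dlsubmx x = 0 -> \tr x = 0 ->
    exists v : V, vsval v = x.
  move=> x0 trx.
  have xV : x \in seaweed_space K (k + 1 + k) [:: k + 1; k]%N [:: (k + 1 + k)%N].
    by apply/mem_parabolicP.
  by exists (Subvs xV).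
(* [F] is extended to all matrices through a projection onto the seaweed. The indices are swapped so
   that [M] represents the extension by the trace form. *)
pose M : 'M[K]_(k + 1 + k) := \matrix_(i, j)
  F (vsproj (seaweed_space K (k + 1 + k) [:: k + 1; k]%N [:: (k + 1 + k)%N])
       (delta_mx j i)).
have FE v : F v = \tr (M *m vsval v).
  transitivity (\sum_i \sum_j vsval v i j * M j i).
    rewrite -[v in LHS]vsvalK [vsval v in LHS]matrix_sum_delta !linear_sum /=.
    apply: eq_bigr => i _; rewrite !linear_sum; apply: eq_bigr => j _ /=.
    by rewrite !linearZ mxE.
  rewrite exchange_big /mxtrace; apply: eq_bigr => i _; rewrite mxE.
  by apply: eq_bigr => j _; rewrite mulrC.
have [a [cA cD]] : exists a : K,
    char_poly (ulsubmx (vsval w)) = \prod_(i < k.+1) ('X - (a - i%:R)%:P) /\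
    char_poly (drsubmx (vsval w)) = \prod_(i < k) ('X - (a - 2%:R - i%:R)%:P).
  apply: (principal_char_poly (M := M)).
  - exact: (upper w).2.
  - move=> x x0 trx xker; have [v vx] := lift _ x0 trx.
    have v0 : v = 0; last by rewrite -vx v0.
    by apply: frobF => y; rewrite FE /= vx; apply: xker; case: (upper y).
  - move=> x x0 trx; have [v <-] := lift _ x0 trx.
    by rewrite -FE -princF FE.
pose rsA : seq K := [seq a - i%:R | i <- iota 0 k.+1].
pose rsD : seq K := [seq a - 2%:R - i%:R | i <- iota 0 k].
have uniq_rs (b : K) m : uniq [seq b - i%:R | i <- iota 0 m].
  rewrite map_inj_uniq ?iota_uniq// => i j /addrI/oppr_inj/eqP.
  by rewrite eqr_nat => /eqP.
have prod_rs (b : K) m : \prod_(i < m) ('X - (b - i%:R)%:P)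
    = \prod_(x <- [seq b - i%:R | i <- iota 0 m]) ('X - x%:P).
  by rewrite -(big_mkord xpredT (fun i => 'X - (b - i%:R)%:P)) /index_iota subn0 big_map.
rewrite prod_rs in cA; rewrite prod_rs in cD.
rewrite /eigenvalue_mset; case: closed_field_poly_normal => r /=.
set e := vbasis _ => cw.
(* A 0 is adjoined to both lists to match the factor ['X] contributed by the scalars. *)
apply/eq_seq_msetP; rewrite -(perm_cons 0) perm_sym.
apply: perm_trans (perm_map _ (perm_spectrum_seq k_gt0)) _.
rewrite perm_sym; apply: prod_XsubC_eq.
rewrite big_cons subr0 mulrC.
have -> : \prod_(x <- r) ('X - x%:P) = char_poly (mxof e e (ad w)).
  by rewrite [RHS]cw (monicP (char_poly_monic _)) scale1r.
have cpE : char_poly (mxof e e (ad w)) * 'X = char_poly (parabolic_ad_mx (vsval w)).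
  exact: esym (char_poly_parabolic_ad w n_gt0).
rewrite cpE.
rewrite /parabolic_ad_mx !char_poly_lblock.
rewrite (char_poly_sylvester cA (uniq_rs _ _) cD (uniq_rs _ _)).
rewrite (char_poly_sylvester cA (uniq_rs _ _) cA (uniq_rs _ _)).
rewrite (char_poly_sylvester cD (uniq_rs _ _) cD (uniq_rs _ _)).
rewrite -!big_cat; congr (\prod_(z <- _) _).
(* The unknown [a] cancels in every difference; on the upper right block
   [(a - i) - (a - 2 - j) = 2 + j - i]. *)
rewrite map_cat; congr (_ ++ _); last (rewrite map_cat; congr (_ ++ _)).
all: rewrite map_allpairs allpairs_mapl allpairs_mapr.
all: apply: eq_allpairs => i j.
all: rewrite ?rmorphD !rmorphN /= -!pmulrn; ring.
Qed.

(** * The Frobenius functional *)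

Definition shift_mx (K : nzRingType) (k s : nat) : 'M[K]_(k, k + 1) :=
  \matrix_(i, j) ((i + s)%N == j :> nat)%:R.

Lemma shift_mxl (K : nzRingType) (k s m : nat) (i : 'I_k) (l : 'I_(k + 1))
    (A : 'M[K]_(k + 1, m)) j :
  (i + s)%N = l -> (shift_mx K k s *m A) i j = A l j.
Proof.
move=> il; rewrite mxE (bigD1 l)//= mxE il eqxx mul1r big1 ?addr0// => l' l'l.
by rewrite mxE il (inj_eq val_inj) eq_sym (negbTE l'l) mul0r.
Qed.

Lemma shift_mxr (K : nzRingType) (k s m : nat) (i : 'I_k) (l : 'I_(k + 1))
    (D : 'M[K]_(m, k)) j :
  (i + s)%N = l -> (D *m shift_mx K k s) j l = D j i.
Proof.
move=> il; rewrite mxE (bigD1 i)//= mxE il eqxx mulr1 big1 ?addr0// => i' i'i.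
by rewrite mxE -il eqn_add2r (inj_eq val_inj) (negbTE i'i) mulr0.
Qed.

Lemma shift_mxr0 (K : nzRingType) (k s m : nat) (l : 'I_(k + 1))
    (D : 'M[K]_(m, k)) j :
  (forall i : 'I_k, (i + s)%N <> l) -> (D *m shift_mx K k s) j l = 0.
Proof.
by move=> nl; rewrite mxE big1// => i _; rewrite mxE; case: eqP => [/nl|]; rewrite ?mulr0.
Qed.

(* The two shifts span Kronecker's indecomposable block of size k x (k+1). *)
Lemma shift_pencil_endomorphism (K : nzRingType) (k : nat)
    (A : 'M[K]_(k + 1)) (D : 'M[K]_k) :
  shift_mx K k 0 *m A = D *m shift_mx K k 0 ->
  shift_mx K k 1 *m A = D *m shift_mx K k 1 ->
  exists a : K, A = a%:M /\ D = a%:M.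
Proof.
move=> C0 C1; have k1_gt0 : (0 < k + 1)%N by rewrite addn1.
have loP (i : 'I_(k + 1)) : (i < k)%N -> exists i' : 'I_k, (i' + 0)%N = i.
  by move=> ik; exists (Ordinal ik); rewrite addn0.
have hiP (i : 'I_(k + 1)) : (0 < i)%N -> exists i' : 'I_k, (i' + 1)%N = i.
  case: i => -[//|i] ik _; have ik' : (i < k)%N by rewrite -ltnS -[k.+1]addn1.
  by exists (Ordinal ik'); rewrite addn1.
(* Row [i] through the shift by 0 and row [i + 1] through the shift by 1 come from the same row of
   [D], so [A] is constant along diagonals. *)
have diag (i j i1 j1 : 'I_(k + 1)) : i1 = i.+1 :> nat -> j1 = j.+1 :> nat ->
    A i1 j1 = A i j.
  move=> ii1 jj1.
  have [|i' i'i] := loP i; first by rewrite -ltnS -ii1 -[k.+1]addn1.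
  have [|j' j'j] := loP j; first by rewrite -ltnS -jj1 -[k.+1]addn1.
  rewrite -(shift_mxl _ _ i'i) C0 (shift_mxr _ _ j'j).
  have i'i1 : (i' + 1)%N = i1 by rewrite ii1 -i'i addn0 addn1.
  have j'j1 : (j' + 1)%N = j1 by rewrite jj1 -j'j addn0 addn1.
  by rewrite -(shift_mxl _ _ i'i1) C1 (shift_mxr _ _ j'j1).
(* An entry below the diagonal slides up to column 0, which is zero in the shift by 1. *)
have low m : forall i j : 'I_(k + 1), j = m :> nat -> (j < i)%N -> A i j = 0.
  elim: m => [|m IH] i j jm ji; have [|i' i'i] := hiP i; rewrite ?(leq_ltn_trans _ ji)//.
    rewrite -(shift_mxl _ _ i'i) C1 shift_mxr0// => l.
    by rewrite jm addn1.
  have [|j' j'j] := hiP j; first by rewrite jm.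
  have lo (l : 'I_k) : (l < k + 1)%N by rewrite addn1 ltnS ltnW.
  rewrite (diag (Ordinal (lo i')) (Ordinal (lo j'))) ?IH//= -?i'i -?j'j ?addn1//.
    by move: j'j; rewrite jm addn1 => -[].
  by move: ji; rewrite -i'i -j'j !addn1.
(* An entry above the diagonal slides down to the last column, which is zero in the shift by 0. *)
have up m : forall i j : 'I_(k + 1), (j + m)%N = k -> (i < j)%N -> A i j = 0.
  elim: m => [|m IH] i j jm ij.
    have [|i' i'i] := loP i; first by rewrite -[X in (_ < X)%N]jm addn0.
    rewrite -(shift_mxl _ _ i'i) C0 shift_mxr0// => l /eqP.
    by rewrite addn0 -[nat_of_ord j]addn0 jm ltn_eqF.
  have jk : (j.+1 < k + 1)%N.
    by rewrite [X in (_ < X)%N]addn1 ltnS -[X in (_ <= X)%N]jm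
      -[X in (X < _)%N]addn0 ltn_add2l.
  have ik : (i.+1 < k + 1)%N by exact: leq_ltn_trans ij (ltn_ord j).
  by rewrite -(diag i j (Ordinal ik) (Ordinal jk))// IH//= addSnnS.
have Aii m : forall i : 'I_(k + 1), i = m :> nat ->
    A i i = A (Ordinal k1_gt0) (Ordinal k1_gt0).
  elim: m => [|m IH] i im; first by congr (A _ _); apply: val_inj.
  have mk : (m < k + 1)%N by apply: ltn_trans (ltn_ord i); rewrite im.
  by rewrite (diag (Ordinal mk) (Ordinal mk))// IH.
have AE : A = (A (Ordinal k1_gt0) (Ordinal k1_gt0))%:M.
  apply/matrixP => i j; rewrite mxE.
  have [->|] := eqVneq i j; first by rewrite mulr1n (Aii j).
  rewrite -(inj_eq val_inj) neq_ltn => /orP[ij|ji]; last exact: low ji.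
  by apply: (up (k - j)%N) => //; rewrite subnKC// -ltnS -[k.+1]addn1.
exists (A (Ordinal k1_gt0) (Ordinal k1_gt0)); split=> //.
move: C0; rewrite AE; set a := A _ _ => C0.
apply/matrixP => i j.
have lo (l : 'I_k) : (l < k + 1)%N by rewrite addn1 ltnS ltnW.
have i0 (l : 'I_k) : (l + 0)%N = Ordinal (lo l) by rewrite addn0.
rewrite -(shift_mxr _ _ (i0 j)) -C0 (shift_mxl _ _ (i0 i)) !mxE.
by rewrite -(inj_eq val_inj).
Qed.

(** As [C C^T = 1], the choice [P = C^T Q] gives [C P = Q], so this [M] realizes the Kronecker
    block. The diagonal blocks of a radical element form an endomorphism of the pencil, hence are
    scalar, and tracelessness makes them 0. *)
Lemma frobenius_functional_exists (K : numClosedFieldType) (k : nat) :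
  exists F : 'Hom(seaweed K (k + 1 + k) [:: k + 1; k]%N [:: (k + 1 + k)%N], K^o),
    frobenius_functional F.
Proof.
set V := seaweed _ _ _ _.
pose C := shift_mx K k 0; pose Q := shift_mx K k 1; pose P := C^T *m Q.
have CC : C *m C^T = 1%:M.
  apply/matrixP => i j.
  have lo (l : 'I_k) : (l < k + 1)%N by rewrite addn1 ltnS ltnW.
  rewrite (@shift_mxl _ _ _ _ _ (Ordinal (lo i))) ?addn0// !mxE addn0.
  by rewrite eq_sym.
pose M : 'M[K]_(k + 1 + k) := block_mx P 0 C 0.
have linF : linear (fun v : V => \tr (M *m vsval v) : K^o).
  by move=> c u v; rewrite [vsval _]linearP mulmxDr -scalemxAr linearP.
pose F : {linear V -> K^o} := HB.pack (fun v : V => \tr (M *m vsval v) : K^o)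
  (GRing.isSemilinear.Build K V K^o _ _ (GRing.semilinear_linear linF)).
exists (linfun F) => v kerv.
have [trv v0] : \tr (vsval v) = 0 /\ dlsubmx (vsval v) = 0.
  exact/mem_parabolicP/subvsP.
have n_gt0 : (0 < k + 1 + k)%N by rewrite addn1.
have n0 : (k + 1 + k)%:R != 0 :> K by rewrite pnatr_eq0 -lt0n.
have [l []] : exists l : K,
    [/\ ulsubmx (M *m vsval v - vsval v *m M) = l%:M,
        drsubmx (M *m vsval v - vsval v *m M) = l%:M
      & dlsubmx (M *m vsval v - vsval v *m M) = 0].
  apply: trace_form_orthogonal => // x x0 trx.
  have xV : x \in seaweed_space K (k + 1 + k) [:: k + 1; k]%N [:: (k + 1 + k)%N].
    exact/mem_parabolicP.
  by have := kerv (Subvs xV); rewrite lfunE /= mxtrace_mul_commutator.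
have [A [B [D vE]]] : exists A B D, vsval v = block_mx A B 0 D.
  exists (ulsubmx (vsval v)), (ursubmx (vsval v)), (drsubmx (vsval v)).
  by rewrite -v0 submxK.
rewrite vE commutator_block_upper block_mxKul block_mxKdr block_mxKdl.
rewrite mul0mx addr0 mulmx0 subr0 => PA CB /eqP; rewrite subr_eq0 => /eqP CA.
(* Taking traces gives [- \tr (B C) = (k + 1) l] and [\tr (C B) = k l], whence [(2 k + 1) l = 0]. *)
have l0 : l = 0.
  have := congr1 mxtrace PA; rewrite !linearB /= [\tr (A *m P)]mxtrace_mulC subrr.
  rewrite sub0r [\tr (B *m C)]mxtrace_mulC CB !mxtrace_scalar => /eqP.
  rewrite eq_sym -addr_eq0 -mulrnDr -mulr_natr mulf_eq0 (negbTE n0) orbF.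
  by move/eqP.
have {}CB : C *m B = 0 by rewrite CB l0 raddf0.
have {}PA : P *m A = A *m P + B *m C.
  by apply/eqP; rewrite -subr_eq0 opprD addrA PA l0 raddf0.
have CP : C *m P = Q by rewrite mulmxA CC mul1mx.
have QA : Q *m A = D *m Q.
  by rewrite -CP -mulmxA PA mulmxDr !mulmxA CB mul0mx addr0 CA.
have [a [Aa Da]] := shift_pencil_endomorphism CA QA.
have a0 : a = 0.
  move: trv; rewrite vE mxtrace_block Aa Da !mxtrace_scalar -mulrnDr -mulr_natr.
  by move/eqP; rewrite mulf_eq0 (negbTE n0) orbF => /eqP.
have B0 : B = 0.
  rewrite -[B]mulmx1 -CC mulmxA; move: PA; rewrite Aa a0 raddf0 mulmx0 mul0mx add0r.
  by move=> <-; rewrite mul0mx.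
apply: val_inj; rewrite /= vE B0 Aa Da a0 !raddf0.
exact: block_mx_const.
Qed.

Theorem mainTheorem3 (R : realType) (k : nat) (hk : (1 <= k)%N) :
  frobenius_with_spectrum
    (seaweed R[i] (2 * k + 1) [:: k + 1; k]%N [:: 2 * k + 1]%N)
    (if k == 1%N then
       msetn 1%N (-1) `+` msetn 2%N 0 `+` msetn 2%N 1 `+` msetn 1%N 2%:R
     else
       (msetn 1%N (- k%:R) `+` msetn (3 * k - 1)%N 0 `+` msetn (3 * k - 1)%N 1
        `+` msetn 1%N (k%:R + 1))
       `+` \big[msetD/mset0]_(1 <= i < k)
             (msetn (3 * i)%N (- k%:R + i%:R)
              `+` msetn (3 * i)%N (k%:R - i%:R + 1)))%mset.
Proof.
rewrite (spectrum_seq_mset _ hk).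
(* The size is written as [p + q] with [p = k + 1] and [q = k], so that matrices split into the
   blocks of the parabolic. *)
have -> : (2 * k + 1)%N = (k + 1 + k)%N by rewrite mul2n -addnn addnAC.
split; first exact: frobenius_functional_exists.
by move=> F w; exact: principal_spectrum.
Qed.
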